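(* Let $X$ be a real Banach space and let $f:[a,b]\to X$ be such that $md(f,x)=1$ for each $x\in[a,b]$. Then the set of points $x\in[a,b]$ such that $f$ is not metrically differentiable at $x$ is $\sigma$-symmetrically porous.
   Context: For $f:[a,b]\to X$, the unilateral metric derivatives are $md_{\pm}(f,x)=\lim_{t\to0+}\frac{\|f(x\pm t)-f(x)\|}{t}$. If both exist and are equal (and finite), their common value is the metric derivative $md(f,x)$; at an endpoint of $[a,b]$ only the one-sided limit taken inside $[a,b]$ is used. The mapping $f$ is metrically differentiable at $x$ if $md(f,x)$ exists and $\|f(y)-f(z)\|-md(f,x)|y-z|=o(|y-x|+|z-x|)$ as $(y,z)\to(x,x)$ with $y,z\in[a,b]$. Symmetric porosity: for $M\subset\mathbb{R}$, $x\in M$, $R>0$, let $S\gamma(x,R,M)$ be the supremum of all $r>0$ for which there exists $z\in\mathbb{R}$ with $B(z,r)\cup B(2x-z,r)\subset B(x,R)\setminus M$, where $B(z,r)=(z-r,z+r)$ (the supremum is $0$ if there is no such $r$). The symmetric upper porosity of $M$ at $x$ is $S\overline{p}(M,x)=2\limsup_{R\to0+}S\gamma(x,R,M)/R$. The set $M$ is symmetrically porous if $S\overline{p}(M,x)>0$ for all $x\in M$. A set is $\sigma$-symmetrically porous if it is a countable union of symmetrically porous sets. *)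

(* Defs.v *)
From HB Require Import structures.
From mathcomp Require Import all_boot all_order all_algebra.
From mathcomp Require Import all_classical all_reals all_analysis.
Set Implicit Arguments.
Unset Strict Implicit.
Unset Printing Implicit Defensive.
Import Order.TTheory GRing.Theory Num.Theory.
Import numFieldNormedType.Exports.
Local Open Scope classical_set_scope.
Local Open Scope ring_scope.

(* A map f : [a, b] -> X is represented by a total f : R -> X; for a < b and x
   in [a, b], none of the notions below depends on the values of f outside
   [a, b]. *)

Definition is_md_right (R : realType) (X : normedModType R) (f : R -> X)
    (x l : R) : Prop :=
  `|f (x + t) - f x| / t @[t --> 0^'+] --> l.

Definition is_md_left (R : realType) (X : normedModType R) (f : R -> X)
    (x l : R) : Prop :=
  `|f (x - t) - f x| / t @[t --> 0^'+] --> l.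

(* "md(f, x) exists and equals l", for f on [a, b] with a < b and x in [a, b]:
   at an endpoint only the limit from inside [a, b] is required. *)
Definition is_md (R : realType) (X : normedModType R) (a b : R) (f : R -> X)
    (x l : R) : Prop :=
  (x < b -> is_md_right f x l) /\ (a < x -> is_md_left f x l).

Definition metrically_differentiable (R : realType) (X : normedModType R)
    (a b : R) (f : R -> X) (x : R) : Prop :=
  exists2 l : R, is_md a b f x l &
    let F := within (`[a, b] `*` `[a, b]) (nbhs (x, x)) in
    (fun yz : R * R => `|f yz.1 - f yz.2| - l * `|yz.1 - yz.2| : R^o) =o_F
    (fun yz : R * R => `|yz.1 - x| + `|yz.2 - x| : R^o).

(* The supremum is taken in R: the set is bounded above by rho, and
   sup set0 = 0. *)
Definition Sgamma (R : realType) (x rho : R) (M : set R) : R :=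
  sup [set r : R | 0 < r /\
    exists z : R, ball z r `|` ball (2 * x - z) r `<=` ball x rho `\` M].

Definition symmetric_upper_porosity (R : realType) (M : set R) (x : R) :
    \bar R :=
  (2%:E * limf_esup (fun rho : R => (Sgamma x rho M / rho)%:E) 0^'+)%E.

Definition symmetrically_porous (R : realType) (M : set R) : Prop :=
  forall x : R, M x -> (0 < symmetric_upper_porosity M x)%E.

Definition sigma_symmetrically_porous (R : realType) (M : set R) : Prop :=
  exists A : nat -> set R,
    (forall n, symmetrically_porous (A n)) /\ M = \bigcup_n A n.

(* Main.v *)
(** If the metric derivative is [1] everywhere, then [f] is [1]-Lipschitz. By the
    triangle inequality, metric differentiability can therefore fail at [x] only
    because, for some [e > 0], there are arbitrarily small [t] with
    [|f (x + t) - f (x - t)| < (2 - e) t]. For such [t], no point [y] close to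
    [x + t] satisfies [|f (x - t) - f y| >= (1 - e / 8) |x - t - y|], and
    symmetrically for [y] close to [x - t] and the point [x + t]. Splitting the
    exceptional set according to [e] and to the radius on which the lower bound
    [|f y - f x| >= (1 - e / 8) |y - x|] holds makes both balls of radius
    [e t / 4] around [x + t] and [x - t] disjoint from the piece containing
    [x]. *)

Require Import Defs.
From HB Require Import structures.
From mathcomp Require Import all_boot all_order all_algebra.
From mathcomp Require Import all_classical all_reals all_analysis.
From mathcomp Require Import lra.
Set Implicit Arguments.
Unset Strict Implicit.
Unset Printing Implicit Defensive.
Import Order.TTheory GRing.Theory Num.Theory.
Import numFieldNormedType.Exports.
Local Open Scope classical_set_scope.
Local Open Scope ring_scope.

(** * Local bounds and the Lipschitz estimate *)

Lemma cvg_norm_quotient_bounds (R : realType) (X : normedModType R)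
    (g : R -> X) (e : R) :
  `|g t| / t @[t --> 0^'+] --> (1 : R) -> 0 < e ->
  exists2 d : R, 0 < d & forall t, 0 < t -> t < d ->
    (1 - e) * t <= `|g t| <= (1 + e) * t.
Proof.
move=> /cvgrPdist_le cg e0.
have /= [d d0 dP] := cg _ e0.
exists d => // t t0 td.
have := dP t; rewrite /= sub0r normrN gtr0_norm// => /(_ td t0).
rewrite ler_norml => /andP[ge_e le_e].
by rewrite -[X in _ && X]ler_pdivrMr// -[X in X && _]ler_pdivlMr//; lra.
Qed.

Lemma is_md1_bounds (R : realType) (X : normedModType R) (a b : R) (f : R -> X)
    (x e : R) : is_md a b f x 1 -> 0 < e ->
  exists2 d : R, 0 < d & forall y, a <= y <= b -> `|y - x| < d ->
    (1 - e) * `|y - x| <= `|f y - f x| <= (1 + e) * `|y - x|.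
Proof.
move=> [mr ml] e0.
have [d1 d10 d1P] : exists2 d : R, 0 < d & forall y, y <= b -> x < y ->
    y - x < d -> (1 - e) * (y - x) <= `|f y - f x| <= (1 + e) * (y - x).
  (* At the right endpoint no [y] is to be tested, so the radius is arbitrary. *)
  have [xb|bx] := ltP x b; last by exists 1 => // y yb xy; lra.
  have [d d0 dP] := cvg_norm_quotient_bounds (mr xb) e0.
  exists d => // y yb xy yd.
  by have := dP (y - x); rewrite (addrC x) subrK; apply; lra.
have [d2 d20 d2P] : exists2 d : R, 0 < d & forall y, a <= y -> y < x ->
    x - y < d -> (1 - e) * (x - y) <= `|f y - f x| <= (1 + e) * (x - y).
  have [ax|xa] := ltP a x; last by exists 1 => // y ay yx; lra.
  have [d d0 dP] := cvg_norm_quotient_bounds (ml ax) e0.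
  exists d => // y ay yx yd.
  by have := dP (x - y); rewrite subKr; apply; lra.
exists (Num.min d1 d2) => [|y /andP[ay yb]]; first by rewrite lt_min d10.
rewrite lt_min; have [yx|xy|->] := ltgtP y x.
- by rewrite distrC gtr0_norm ?subr_gt0// => /andP[_]; apply: d2P.
- by rewrite gtr0_norm ?subr_gt0// => /andP[+ _]; apply: d1P.
- by rewrite !subrr !normr0 !mulr0 lexx.
Qed.

(** Continuous induction from [y], with slack [e] in the slope: the local bound at the supremum [s]
    of the good points shows first that [s] is good, then that [s < z] is impossible. The slack is
    removed at the end. *)
Lemma is_md1_lipschitz (R : realType) (X : normedModType R) (a b : R)
    (f : R -> X) :
  (forall x, a <= x <= b -> is_md a b f x 1) ->
  forall y z, a <= y -> y <= z -> z <= b -> `|f z - f y| <= z - y.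
Proof.
move=> mdf y z ay yz zb.
suff H e : 0 < e -> `|f z - f y| <= (1 + e) * (z - y).
  apply/ler_addgt0Pr => e e0.
  (* Adding [1] avoids a zero denominator when [y = z]. *)
  have p : 0 < z - y + 1 by lra.
  have := H (e / (z - y + 1)) (divr_gt0 e0 p).
  have : e / (z - y + 1) * (z - y) <= e.
    by rewrite mulrAC ler_pdivrMr// ler_pM2l//; lra.
  by rewrite mulrDl mul1r; lra.
move=> e0.
pose S := [set w : R | y <= w <= z /\ `|f w - f y| <= (1 + e) * (w - y)].
have Sy : S y by split; rewrite ?lexx// !subrr normr0 mulr0.
have ubS : ubound S z by move=> w [/andP[]].
have hS : has_sup S by split; [exists y|exists z].
have ys : y <= sup S by apply: sup_upper_bound.
have sz : sup S <= z by apply: ge_sup => //; exists y.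
set s := sup S in ys sz *.
have abs : a <= s <= b by lra.
have [d d0 dP] := is_md1_bounds (mdf s abs) e0.
have Ss : S s.
  split; first by rewrite ys.
  have [w [/andP[yw wz] Sw] sw] := sup_adherent d0 hS.
  have ws : w <= s by apply: sup_upper_bound => //; split => //; rewrite yw.
  have wab : a <= w <= b by lra.
  have := dP w wab; rewrite [`|w - s|]distrC ger0_norm ?subr_ge0//.
  move=> /(_ ltac:(by rewrite -/s in sw; lra)) /andP[_].
  rewrite distrC => sw'.
  by have := ler_distD (f w) (f s) (f y); lra.
suff <- : s = z by have [] := Ss.
apply/eqP; rewrite eq_le sz leNgt; apply/negP => ltsz.
(* Halving [d] gives the strict inequality needed by [dP]; the other term keeps [s + h] below
   [z]. *)
pose h := Num.min (d / 2) (z - s).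
have h0 : 0 < h by rewrite lt_min subr_gt0 ltsz andbT; lra.
have hd : h <= d / 2 by rewrite /h ge_min lexx.
have hz : h <= z - s by rewrite /h ge_min lexx orbT.
have wab : a <= s + h <= b by lra.
have := dP _ wab; rewrite (addrC s) addrK gtr0_norm//.
move=> /(_ ltac:(lra)) /andP[_ fh].
have : S (h + s).
  split; first by lra.
  have [_ fs] := Ss.
  by have := ler_distD (f s) (f (h + s)) (f y); lra.
by move=> /(sup_upper_bound hS); rewrite -/s; lra.
Qed.

(** * Reduction to symmetric pairs *)

Definition symmetric_defect (R : realType) (X : normedModType R) (a b : R)
    (f : R -> X) (e x : R) : Prop :=
  forall d, 0 < d -> exists t, [/\ 0 < t, t < d, a <= x - t, x + t <= b &
    `|f (x + t) - f (x - t)| < (2 - e) * t].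

Definition expands_near (R : realType) (X : normedModType R) (a b : R)
    (f : R -> X) (e d x : R) : Prop :=
  forall y, a <= y <= b -> `|y - x| < d -> (1 - e) * `|y - x| <= `|f y - f x|.

(** The Lipschitz bound is the upper half of the estimate. For the lower half, a pair on one side of
    [x] is compared with [x] itself, and a pair straddling [x] with a pair symmetric about [x]. *)
Lemma metrically_differentiable_lipschitz (R : realType) (X : normedModType R)
    (a b : R) (f : R -> X) (x : R) :
  a <= x <= b -> is_md a b f x 1 ->
  (forall y z, a <= y -> y <= z -> z <= b -> `|f z - f y| <= z - y) ->
  (forall e, 0 < e -> ~ symmetric_defect a b f e x) ->
  metrically_differentiable a b f x.
Proof.
move=> /andP[ax xb] mdx lip nodef; exists 1 => //=.
apply/eqoP => e e0.
have [d1 d10 d1P] := is_md1_bounds mdx e0.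
have [d2 d20 d2P] : exists2 d : R, 0 < d & forall t, 0 < t -> t < d ->
    a <= x - t -> x + t <= b -> (2 - e) * t <= `|f (x + t) - f (x - t)|.
  apply: contrapT => H; apply: (nodef _ e0) => d d0.
  apply: contrapT => H'; apply: H; exists d => // t t0 td h1 h2.
  by rewrite leNgt; apply/negP => h3; apply: H'; exists t.
(* Symmetric pairs fit in [[a, b]] only around interior points; at an endpoint no pair straddles
   [x]. *)
have [d3 d30 d3P] : exists2 d : R, 0 < d & a < x -> x < b ->
    forall t, t < d -> a <= x - t /\ x + t <= b.
  have [ax'|?] := ltP a x; last by exists 1 => //; lra.
  have [xb'|?] := ltP x b; last by exists 1 => //; lra.
  exists (Num.min (x - a) (b - x)); first by rewrite lt_min !subr_gt0 ax'.
  by move=> _ _ t; rewrite lt_min => /andP[? ?]; split; lra.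
pose d := Num.min d1 (Num.min d2 d3).
have d0 : 0 < d by rewrite !lt_min d10 d20 d30.
have key y z : a <= y -> y <= z -> z <= b -> `|y - x| < d -> `|z - x| < d ->
    z - y - e * (`|y - x| + `|z - x|) <= `|f z - f y|.
  move=> ay yz zb; rewrite !lt_min => /and3P[yd1 yd2 yd3] /and3P[zd1 zd2 zd3].
  have yab : a <= y <= b by lra.
  have zab : a <= z <= b by lra.
  have /andP[fy _] := d1P y yab yd1.
  have /andP[fz _] := d1P z zab zd1.
  have [xy|yx] := leP x y.
    have xz : x <= z by lra.
    move: fy fz; rewrite !ger0_norm ?subr_ge0// => fy fz.
    have ly := lip x y ax xy (ltac:(lra)).
    have := ler_distD (f y) (f z) (f x).
    have : 0 <= e * (y - x) by rewrite mulr_ge0 ?subr_ge0// ltW.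
    lra.
  have [zx|xz] := leP z x.
    move: fy fz; rewrite [`|y - x|]distrC [`|z - x|]distrC.
    rewrite gtr0_norm ?subr_gt0// ger0_norm ?subr_ge0// => fy fz.
    have lz := lip z x (ltac:(lra)) zx xb.
    have := ler_distD (f z) (f y) (f x).
    rewrite (distrC (f y) (f z)) (distrC (f z) (f x)).
    have : 0 <= e * (x - z) by rewrite mulr_ge0 ?subr_ge0// ltW.
    lra.
  move: yd2 yd3 zd2 zd3 {fy fz yd1 zd1}.
  rewrite [`|y - x|]distrC !gtr0_norm ?subr_gt0// => yd2 yd3 zd2 zd3.
  have ax' : a < x by lra.
  have xb' : x < b by lra.
  have ey : 0 <= e * (x - y) by rewrite mulr_ge0 ?subr_ge0// ltW.
  have ez : 0 <= e * (z - x) by rewrite mulr_ge0 ?subr_ge0// ltW.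
  (* The nearer point is moved outward to the mirror image of the farther one; this costs at most
     the length of the move, so the total loss is [e] times the larger distance. *)
  have [yzx|zyx] := leP (x - y) (z - x).
    have [h1 h2] := d3P ax' xb' _ zd3.
    have := d2P (z - x) (ltac:(lra)) zd2 h1 h2.
    rewrite (addrC x) subrK => fzz.
    have lz := lip (x - (z - x)) y h1 (ltac:(lra)) (ltac:(lra)).
    have := ler_distD (f y) (f z) (f (x - (z - x))).
    lra.
  have [h1 h2] := d3P ax' xb' _ yd3.
  have := d2P (x - y) (ltac:(lra)) yd2 h1 h2.
  rewrite subKr => fyy.
  have ly := lip z (x + (x - y)) (ltac:(lra)) (ltac:(lra)) h2.
  have := ler_distD (f z) (f (x + (x - y))) (f y).
  lra.
have key2 y z : a <= y -> y <= z -> z <= b -> `|y - x| < d -> `|z - x| < d ->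
    `| `|f z - f y| - (z - y)| <= e * (`|y - x| + `|z - x|).
  move=> ay yz zb yd zd.
  have h1 := key y z ay yz zb yd zd; have h2 := lip y z ay yz zb.
  by rewrite ler0_norm; lra.
exists (ball x d, ball x d) => /=.
  by split; apply: nbhsx_ballx.
move=> [y z] /= [yd zd] [].
rewrite /= !in_itv/= => /andP[ay yb] /andP[az zb].
move: yd zd; rewrite /ball/= (distrC x y) (distrC x z) => yd zd.
rewrite mul1r [leRHS](_ : _ = e * (`|y - x| + `|z - x|)); last first.
  by congr (_ * _); rewrite ger0_norm// addr_ge0.
have [yz|zy] := leP y z.
  rewrite (distrC (f y)) (distrC y z) (ger0_norm (_ : 0 <= z - y)) ?subr_ge0//.
  exact: key2.
rewrite (gtr0_norm (_ : 0 < y - z)) ?subr_gt0// [X in _ * X]addrC.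
by apply: key2 => //; apply: ltW.
Qed.

(** * Porosity from symmetric holes *)

(** As [c <= 1], both holes lie in the ball of radius [2 * t] about [x], so at that scale the ratio
    is at least [c / 2]. *)
Lemma symmetric_upper_porosity_gt0 (R : realType) (M : set R) (x c : R) :
  0 < c -> c <= 1 ->
  (forall d, 0 < d -> exists t, [/\ 0 < t, t < d &
     ball (x + t) (c * t) `|` ball (x - t) (c * t) `<=` ~` M]) ->
  (0 < symmetric_upper_porosity M x)%E.
Proof.
move=> c0 c1 H.
apply: mule_gt0 => //.
apply: (@lt_le_trans _ _ (c / 2)%:E); first by rewrite lte_fin divr_gt0.
apply: le_ereal_inf_tmp => _ [V [d /= d0 dV] <-].
have [t [t0 td tM]] := H (d / 2) (divr_gt0 d0 (ltr0n _ 2)).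
have Vt : V (2 * t).
  by apply: dV; rewrite /= ?sub0r ?normrN ?gtr0_norm; lra.
apply: (@le_trans _ _ (Sgamma x (2 * t) M / (2 * t))%:E); last first.
  by apply: ereal_sup_ubound; exists (2 * t).
rewrite lee_fin ler_pdivlMr; last by lra.
rewrite mulrA divfK ?pnatr_eq0//.
rewrite /Sgamma; set S := [set r : R | _].
have Sct : S (c * t).
  split; first exact: mulr_gt0.
  exists (x + t) => y; rewrite (_ : 2 * x - (x + t) = x - t); last by lra.
  move=> yB; split; last exact: tM.
  have : c * t <= t by rewrite ger_pMl.
  by case: yB; rewrite /ball/= !ltr_distl; lra.
apply: sup_upper_bound => //; split; first by exists (c * t).
(* A crude bound, making the real supremum meaningful: [z] and [z + r / 2] both lie within [2 * t]
   of [x]. *)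
exists (8 * t) => r [r0 [z zP]].
have [|+ _] := zP z; first by left; apply: ballxx.
have [|+ _] := zP (z + r / 2).
  by left; rewrite /ball/= ltr_distl; lra.
by rewrite /ball/= !ltr_distl; lra.
Qed.

(** The defect is taken at [x], but the expansion at a supposed point [y] of [M] in a hole; hence
    [d] must be uniform over [M]. *)
Lemma symmetrically_porous_defect (R : realType) (X : normedModType R)
    (a b : R) (f : R -> X) (e d : R) (M : set R) :
  0 < e -> e <= 1 -> 0 < d ->
  (forall y z, a <= y -> y <= z -> z <= b -> `|f z - f y| <= z - y) ->
  (forall x, M x -> [/\ a <= x <= b, symmetric_defect a b f e x &
     expands_near a b f (e / 8) d x]) ->
  symmetrically_porous M.
Proof.
move=> e0 e1 d0 lip HM x /HM[_ defx _].
have lip' u v : a <= u <= b -> a <= v <= b -> `|f u - f v| <= `|u - v|.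
  move=> /andP[? ?] /andP[? ?]; have [uv|vu] := leP u v.
    rewrite distrC [leRHS]distrC (ger0_norm (_ : 0 <= v - u)) ?subr_ge0//.
    exact: lip.
  rewrite (gtr0_norm (_ : 0 < u - v)) ?subr_gt0//.
  by apply: lip => //; apply: ltW.
apply: (@symmetric_upper_porosity_gt0 _ _ _ (e / 4)); [lra|lra|].
move=> h h0.
(* The third of [d] ensures [|p - y| < 2 * t + e / 4 * t < d] below. *)
have [|t [t0 th axt xtb def]] := defx (Num.min h (d / 3)).
  by rewrite lt_min h0; lra.
move: th; rewrite lt_min => /andP[th td].
have et0 : 0 < e * t by rewrite mulr_gt0.
have et1 : e * t <= t by rewrite ger_pMl.
(* [p] is the far endpoint and [q] the centre of the hole. *)
have hole p q y : a <= p <= b -> a <= q <= b -> `|p - q| = 2 * t ->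
    `|f p - f q| < (2 - e) * t -> `|q - y| < e / 4 * t -> ~ M y.
  move=> pab qab pq fpq qy /HM[yab _ ey].
  have py1 := ler_distD q p y.
  have py2 := ler_distD y p q; rewrite (distrC y q) in py2.
  have := ey p pab ltac:(lra).
  have := ler_distD (f q) (f p) (f y).
  have := lip' q y qab yab.
  (* The left side is at least [2 * t - e * t / 2], while the path through [q] gives less than
     [2 * t - 3 * e * t / 4]. *)
  have : (1 - e / 8) * (2 * t - e / 4 * t) <= (1 - e / 8) * `|p - y|.
    by rewrite ler_pM2l; lra.
  have : 0 <= e * (e * t) by rewrite mulr_ge0 ?ltW.
  lra.
have xm : a <= x - t <= b by lra.
have xp : a <= x + t <= b by lra.
exists t; split => // y [] yB.
  apply: (hole (x - t) (x + t)) => //; last by rewrite distrC.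
  by rewrite distrC gtr0_norm; lra.
by apply: (hole (x + t) (x - t)) => //; rewrite gtr0_norm; lra.
Qed.

Theorem proposition4p5 (R : realType) (X : completeNormedModType R) (a b : R)
    (ltab : a < b) (f : R -> X)
    (mdf : forall x : R, x \in `[a, b] -> is_md a b f x 1) :
  sigma_symmetrically_porous
    [set x : R | x \in `[a, b] /\ ~ metrically_differentiable a b f x].
Proof.
have md1 x : a <= x <= b -> is_md a b f x 1.
  by move=> xab; apply: mdf; rewrite in_itv.
have lip := is_md1_lipschitz md1.
set N := [set x | _].
pose eps (n : nat) : R := n.+1%:R^-1.
have eps_gt0 n : 0 < eps n by rewrite invr_gt0.
have eps_lt (e : R) : 0 < e -> exists n, eps n < e.
  move=> e0; have [n _ /(_ n (leqnn n))] := near_infty_natSinv_lt (PosNum e0).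
  by exists n.
pose B n k := [set x | [/\ N x, symmetric_defect a b f (eps n) x &
  expands_near a b f (eps n / 8) (eps k) x]].
(* Integers coding no pair give the empty set, which is vacuously porous. *)
exists (fun m => if unpickle m is Some (n, k) then B n k else set0).
split=> [m|].
  case: (unpickle m) => [[n k]|] //.
  apply: (@symmetrically_porous_defect _ _ a b f (eps n) (eps k)) => //.
    by rewrite invf_le1// ler1n.
  by move=> x [[xab _] dx ex]; split => //; move: xab; rewrite in_itv.
apply/seteqP; split=> [x Nx|x [m _]]; last first.
  by case: (unpickle m) => [[n k]|] // [].
have [xab nmd] := Nx.
have xab' : a <= x <= b by move: xab; rewrite in_itv.
have [n defn] : exists n, symmetric_defect a b f (eps n) x.
  apply: contrapT => H; apply: nmd.
  apply: metrically_differentiable_lipschitz => // [|e e0 def]; first exact: md1.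
  (* A defect for [e] is also one for every smaller constant. *)
  apply: H; have [n ne] := eps_lt _ e0; exists n => d d0.
  have [t [t0 td h1 h2 h3]] := def d d0; exists t; split => //.
  by apply: lt_le_trans h3 _; rewrite ler_pM2r//; lra.
have e8 : 0 < eps n / 8 by rewrite divr_gt0.
have [d d0 dP] := is_md1_bounds (md1 x xab') e8.
have [k kd] := eps_lt _ d0.
exists (pickle (n, k)) => //; rewrite pickleK; split=> // y yab yk.
by have /andP[] := dP y yab (lt_trans yk kd).
Qed.
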